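(* Assume that $\operatorname{cov}(\mathcal{M})=\mathfrak{c}$. Then (Setting (5.a)) there is a subgroup of $\mathbb{Z}^{\mathbb{N}}$ which is Hurewicz-bounded, Menger-bounded, and Rothberger-bounded, and has the Menger property and the Rothberger property, but does not have the Hurewicz property.
   Context: $\mathfrak{c}=2^{\aleph_0}$, and $\operatorname{cov}(\mathcal{M})$ is the minimal cardinality of a cover of $\mathbb{R}$ by meager sets; equivalently, of $Y\subseteq\mathbb{N}^{\mathbb{N}}$ such that there is no $f\in\mathbb{N}^{\mathbb{N}}$ with the property that for each $y\in Y$, $f(n)=y(n)$ for some $n$. The group $\mathbb{Z}^{\mathbb{N}}$ carries pointwise addition and the product topology ($\mathbb{Z}$ discrete); subgroups carry the subspace topology. For a topological group $(G,\cdot)$, with the condition required for each sequence $(U_n)_{n\in\mathbb{N}}$ of neighborhoods of the unit: $G$ is Menger-bounded if there are finite $F_n\subseteq G$ with $G=\bigcup_n F_n\cdot U_n$; Hurewicz-bounded if there are finite $F_n\subseteq G$ such that each $g\in G$ belongs to $F_n\cdot U_n$ for all but finitely many $n$; Rothberger-bounded if there are $a_n\in G$ with $G=\bigcup_n a_n\cdot U_n$. For a topological space $X$, with the condition required for each sequence $(\mathcal{U}_n)_{n\in\mathbb{N}}$ of open covers of $X$: $X$ has the Menger property if there are finite $\mathcal{F}_n\subseteq\mathcal{U}_n$ such that $\bigcup_n\mathcal{F}_n$ covers $X$; the Hurewicz property if there are finite $\mathcal{F}_n\subseteq\mathcal{U}_n$ such that each $x\in X$ belongs to $\bigcup_{U\in\mathcal{F}_n}U$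 for all but finitely many $n$; the Rothberger property if there are $U_n\in\mathcal{U}_n$ with $X=\bigcup_n U_n$. *)

(* Defs.v *)
From HB Require Import structures.
From mathcomp Require Import all_boot all_order all_algebra.
From mathcomp Require Import all_classical all_reals all_analysis.

Set Implicit Arguments.
Unset Strict Implicit.
Unset Printing Implicit Defensive.

Import Order.TTheory GRing.Theory Num.Theory.
Import numFieldTopology.Exports.

Local Open Scope classical_set_scope.
Local Open Scope ring_scope.
Local Open Scope card_scope.

Section Meager.
Context {T : topologicalType}.

Definition nowhere_dense (A : set T) : Prop := interior (closure A) = set0.

Definition meager (A : set T) : Prop :=
  exists2 F : nat -> set T,
    forall n, nowhere_dense (F n) & A = \bigcup_n F n.

Definition meager_cover (C : set (set T)) : Prop :=
  (forall A, C A -> meager A) /\ \bigcup_(A in C) A = [set: T].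

End Meager.

(* Cardinal numbers are represented by sets, compared by #<= and #= :
   [cov_meager_eq R K] says that the cardinality of K is the minimal
   cardinality of a cover of the real line by meager sets. *)
Definition cov_meager_eq (R : realType) (U : Type) (K : set U) : Prop :=
  (exists2 C : set (set R), meager_cover C & C #= K) /\
  (forall C : set (set R), meager_cover C -> K #<= C).

Section CoveringProperties.
Variable X : topologicalType.

Definition open_cover (U : set (set X)) : Prop :=
  (forall A, U A -> open A) /\ \bigcup_(A in U) A = [set: X].

Definition Menger_property : Prop :=
  forall U : nat -> set (set X), (forall n, open_cover (U n)) ->
  exists F : nat -> set (set X),
    (forall n, finite_set (F n) /\ F n `<=` U n) /\
    \bigcup_n \bigcup_(A in F n) A = [set: X].

Definition Hurewicz_property : Prop :=
  forall U : nat -> set (set X), (forall n, open_cover (U n)) ->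
  exists F : nat -> set (set X),
    (forall n, finite_set (F n) /\ F n `<=` U n) /\
    (forall x, \forall n \near \oo, (\bigcup_(A in F n) A) x).

Definition Rothberger_property : Prop :=
  forall U : nat -> set (set X), (forall n, open_cover (U n)) ->
  exists A : nat -> set X,
    (forall n, U n (A n)) /\ \bigcup_n A n = [set: X].

End CoveringProperties.

Section BoundednessProperties.
Variable G : topologicalZmodType.

Definition addset (A B : set G) : set G := [set a + b | a in A & b in B].

Definition Menger_bounded : Prop :=
  forall U : nat -> set G, (forall n, nbhs 0 (U n)) ->
  exists F : nat -> set G,
    (forall n, finite_set (F n)) /\
    \bigcup_n addset (F n) (U n) = [set: G].

Definition Hurewicz_bounded : Prop :=
  forall U : nat -> set G, (forall n, nbhs 0 (U n)) ->
  exists F : nat -> set G,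
    (forall n, finite_set (F n)) /\
    (forall g, \forall n \near \oo, addset (F n) (U n) g).

Definition Rothberger_bounded : Prop :=
  forall U : nat -> set G, (forall n, nbhs 0 (U n)) ->
  exists a : nat -> G,
    \bigcup_n addset [set a n] (U n) = [set: G].

End BoundednessProperties.

HB.instance Definition _ := GRing.Zmodule.copy (discrete_topology int) int.

Definition ZN : Type := {ptws nat -> discrete_topology int}.

HB.instance Definition _ := Topological.copy ZN {ptws nat -> discrete_topology int}.
HB.instance Definition _ :=
  GRing.Zmodule.copy ZN (nat -> discrete_topology int).

Lemma continuous_to_prod (X : topologicalType) (I : Type)
    (K : I -> topologicalType) (f : X -> prod_topology K) :
  (forall i, continuous (fun x => f x i)) -> continuous f.
Proof.
move=> fc x; apply/cvg_sup => i U [_ [/= [W oW <-] /= Wfx]] /filterS; apply.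
by apply: fc; exact: open_nbhs_nbhs.
Qed.

Lemma ZN_sub_continuous : continuous (fun x : ZN * ZN => x.1 - x.2).
Proof.
apply: (@continuous_to_prod _ nat (fun=> discrete_topology int)) => n [x y].
have proj_n (f : ZN) : \forall g \near f, g n = f n.
  have := @proj_continuous nat (fun=> discrete_topology int) n f [set f n].
  by apply; exact: discrete_set1.
move=> U /nbhs_singleton Uxy.
exists ([set f | f n = x n], [set f | f n = y n]); first by split; exact: proj_n.
move=> [f g] [/= fx gy].
by change (U (f n - g n)); rewrite fx gy.
Qed.

HB.instance Definition _ :=
  PreTopologicalNmodule_isTopologicalZmodule.Build ZN ZN_sub_continuous.

Section Subgroup.
Context {M : topologicalZmodType}.

(* The subgroup G of M as a topological group of its own, with the
   operations and the topology inherited from M. *)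
Definition subgroup (G : zmodClosed M) : Type := {x : M | x \in G}.

Variable G : zmodClosed M.

HB.instance Definition _ := SubChoice.on (subgroup G).
HB.instance Definition _ := [SubChoice_isSubZmodule of subgroup G by <:].
HB.instance Definition _ :=
  Topological.copy (subgroup G) (initial_topology (val : subgroup G -> M)).

Lemma subgroup_sub_continuous :
  continuous (fun x : subgroup G * subgroup G => x.1 - x.2).
Proof.
move=> x; apply: continuous_comp_initial => {x} -[x y].
apply: (@continuous_comp _ (M * M)%type _
  (fun p : subgroup G * subgroup G => (val p.1, val p.2))
  (fun p : M * M => p.1 - p.2)); last exact: sub_continuous.
apply: cvg_pair; apply: continuous_comp.
- exact: cvg_fst.
- exact: initial_continuous.
- exact: cvg_snd.
- exact: initial_continuous.
Qed.

HB.instance Definition _ := PreTopologicalNmodule_isTopologicalZmodule.Build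
  (subgroup G) subgroup_sub_continuous.

End Subgroup.

(* Main.v *)
Require Import Defs.
From HB Require Import structures.
From mathcomp Require Import all_boot all_order all_algebra.
From mathcomp Require Import all_classical all_reals all_analysis.
From mathcomp Require Import zify lra.

(* The group G consists of all q + k_1 x_(i_1) + ... + k_m x_(i_m) with q
   finitely supported, k_j integers and i_j < c, where each x_i in 2^N is chosen
   by recursion to be Cohen generic over the tasks coded by finitely many
   smaller indices; cov(M) = c makes this possible.  All members of G are
   bounded functions, so G is Hurewicz-bounded.  By genericity no member of G is
   eventually 1, hence the sets {g : g i <> 1 for some i in [n, n + j]}, j in N,
   form an open cover for each n; but some x_i is constantly 1 on infinitely
   many of any prescribed intervals [n, n + J n], so G is not Hurewicz.

   For the Rothberger property split the covers into infinitely many infinite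
   subsequences.  Given k_j < c, a selection from the j-th subsequence which is
   generic over the span of {x_i : i < k_j} has a union V_j such that
   h + k_1 x_(i_1) + ... + k_m x_(i_m) lies in V_j whenever h is in that
   span and all i_1, ..., i_m are at least some k_(j+1) < c.  An element of G
   involves only finitely many x_i, so for some j no index of it lies in
   [k_j, k_(j+1)), and it then belongs to V_j. *)

Set Implicit Arguments.
Unset Strict Implicit.
Unset Printing Implicit Defensive.

Import Order.TTheory GRing.Theory Num.Theory.
Import numFieldTopology.Exports numFieldNormedType.Exports.

Local Open Scope classical_set_scope.
Local Open Scope ring_scope.
Local Open Scope card_scope.

(** * Cardinality bounds through codes by finite sequences *)

Lemma inj_in_card_le (T U : Type) (A : set T) (B : set U) (f : T -> U) :
  (forall x, A x -> B (f x)) -> set_inj A f -> A #<= B.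
Proof.
move=> AB fI; have [g] : $|{injfun A >-> B}| by apply/injfunPex; exists f.
exact: inj_card_le g.
Qed.

Lemma uncountable_set_nat : ~ ([set: set nat] #<= [set: nat]).
Proof.
move=> /pcard_injP[f fI].
pose D := [set n | exists2 A : set nat, f A = n & ~ A n].
have fD (A : set nat) : f A = f D -> A = D.
  by move=> e; apply: fI; rewrite ?in_setT.
have [Df|nDf] := pselect (D (f D)); last by apply: (nDf); exists D.
by have [A /fD -> ] := Df.
Qed.

Section Codes.
Variable T : choiceType.
Implicit Types (A : set T) (c : nat * seq T).

(** The tag in [nat] absorbs any countable data through [pickle], and [large A] below amounts to [A]
    having at least continuum many elements. *)
Definition codes A : set (nat * seq T) := [set c | forall d, d \in c.2 -> A d].

Definition large A := [set: set nat] #<= codes A.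

Lemma large_nonempty A : large A -> A !=set0.
Proof.
move=> bA; apply/set0P/eqP => A0; apply: uncountable_set_nat.
apply: card_le_trans bA _.
apply: (@inj_in_card_le _ _ _ _ (fun c => c.1)) => // -[n [|d l]] [m [|e k]].
- by move=> _ _ /= ->.
- by move=> _ /set_mem /= /(_ e (mem_head _ _)); rewrite A0.
- by move=> /set_mem /= /(_ d (mem_head _ _)); rewrite A0.
- by move=> /set_mem /= /(_ d (mem_head _ _)); rewrite A0.
Qed.

(** Undoes the deletion of [a] from a sequence, given the mask of the positions of [a]. *)
Fixpoint unmask (a : T) (m : seq bool) (l : seq T) :=
  match m, l with
  | true :: m', _ => a :: unmask a m' l
  | false :: m', d :: l' => d :: unmask a m' l'
  | _, _ => [::]
  end.

Lemma unmaskK a l : unmask a [seq d == a | d <- l] [seq d <- l | d != a] = l.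
Proof. by elim: l => //= d l; case: eqP => /= [->|_] ->. Qed.

(** The positions of [a] in a sequence are countable data and move into the tag; the remaining
    entries lie in [A]. *)
Lemma large_setU1 A a : large (a |` A) -> large A.
Proof.
move=> /card_le_trans; apply.
pose f c := (pickle (c.1, [seq d == a | d <- c.2]), [seq d <- c.2 | d != a]).
apply: (@inj_in_card_le _ _ _ _ f) => [[n l] /= h d|[n l] [m k] _ _].
  by rewrite mem_filter => /andP[/eqP da /h[]].
move=> [/(pcan_inj pickleK)[-> e] e'].
by rewrite -(unmaskK a l) e e' unmaskK.
Qed.

End Codes.

(** * Well-orders whose proper initial segments are not large *)

Definition strict_well_order (T : Type) (lt : rel T) :=
  [/\ irreflexive lt, transitive lt,
      forall x y, ~~ lt x y -> ~~ lt y x -> x = y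
    & forall A : set T, A !=set0 ->
        exists2 x, A x & forall y, A y -> ~~ lt y x].

(** Totality, antisymmetry and transitivity of [R] come from least elements of sets of at most three
    points. *)
Lemma strict_well_order_exists (T : eqType) :
  exists lt : rel T, strict_well_order lt.
Proof.
have [R Rwo] := wochoice.well_ordering_principle T.
have Rmin (A : set T) : A !=set0 ->
    exists2 x, A x & forall y, A y -> R x y.
  move=> [a Aa]; have [|x [[Ax mx] _]] := Rwo (fun x => `[<A x>]).
    by exists a; apply/asboolP.
  by exists x => [|y Ay]; [exact/asboolP|apply/mx/asboolP].
have Rtot x y : R x y || R y x.
  have [|_ [->|->] m] := Rmin [set x; y]; first by exists x; left.
    by rewrite m//; right.
  by rewrite (m x) ?orbT//; left.
have Rxx x : R x x by have := Rtot x x; rewrite orbb.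
have Ranti x y : R x y -> R y x -> x = y.
  move=> xy yx; have [|z [_ zu]] := Rwo [pred z | (z == x) || (z == y)].
    by exists x; rewrite inE eqxx.
  transitivity z; [apply/esym|]; apply: zu; split; rewrite ?inE ?eqxx ?orbT//;
    by move=> t; rewrite inE => /orP[]/eqP->.
have Rtr y x z : R x y -> R y z -> R x z.
  move=> xy yz; have [|_ [[->|->]|->] m] := Rmin [set x; y; z].
  - by exists x; left; left.
  - by apply: m; right.
  - by rewrite (Ranti x y) //; apply: m; left; left.
  - by rewrite -(Ranti y z) //; apply: m; left; right.
exists (fun x y => ~~ R y x); split.
- by move=> x; rewrite Rxx.
- move=> y x z /= yx zy; apply/negP => zx.
  have /orP[xy|yx'] := Rtot x y; last by rewrite yx' in yx.
  by rewrite (Rtr x) in zy.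
- by move=> x y; rewrite !negbK => yx xy; apply: Ranti.
- by move=> A /Rmin[x Ax m]; exists x => // y /m xy; rewrite negbK.
Qed.

(* T is the least initial segment of a well-order of c having at least c finite
   sequences.  Counting finite sequences rather than points makes the tasks
   below a given index fewer than c without proving that k * k = k. *)
Lemma large_well_order : exists (T : choiceType) (lt : rel T),
  [/\ strict_well_order lt, large [set: T],
      forall i, ~ large [set d | lt d i] & forall i, exists j, lt i j].
Proof.
pose S : choiceType := set nat.
have [lt ltwo] := strict_well_order_exists S.
have [ltxx lttr lttot ltmin] := ltwo.
have [P [Pdown Plarge Psmall]] : exists P : set S,
    [/\ forall d i, P i -> lt d i -> P d, large P
      & forall i, P i -> ~ large [set d | lt d i]].
  (* Take the points below the least [i0] whose segment is large, or everything if there is no such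
     point. *)
  have [[i li]|no] := pselect (exists i, large [set d : S | lt d i]).
    have [|i0 li0 m] := ltmin (fun i => large [set d : S | lt d i]).
      by exists i.
    exists [set d | lt d i0]; split=> // [d e /= ei de|e /= ei le].
      exact: lttr ei.
    by have := m e le; rewrite ei.
  exists setT; split=> // [|i _ li]; last by apply: no; exists i.
  apply: (@inj_in_card_le _ _ _ _ (fun x : S => (0%N, [:: x]))) => //.
  by move=> x y _ _ [].
(* If [i] were last, [P] would be the segment below [i] with [i] added, and that segment would be
   large by [large_setU1]. *)
have Pnomax i : P i -> exists2 j, P j & lt i j.
  move=> Pi; apply: contrapT => no; apply: (Psmall i Pi).
  apply: (@large_setU1 _ _ i).
  apply: card_le_trans Plarge _; apply: subset_card_le => -[n l] /= h d /h Pd.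
  have [<-|/eqP di] := eqVneq d i; [by left|right => /=].
  apply: contrapT => /negP ndi; apply: no; exists d => //.
  by apply: contrapT => /negP nid; apply: di; apply: lttot.
have valI : injective (val : {x : S | x \in P} -> S) by exact: val_inj.
exists {x : S | x \in P}, (fun x y => lt (val x) (val y)); split.
- split=> [x|y x z|x y h1 h2|A [a Aa]] //; first exact: lttr.
    by apply/val_inj/lttot.
  have [|_ [x Ax <-] m] := ltmin (val @` A); first by exists (val a), a.
  by exists x => // y Ay; apply: m; exists y.
- have [p0 Pp0] := large_nonempty Plarge.
  pose emb d : {x : S | x \in P} :=
    if pselect (P d) is left Pd then exist _ d (mem_set Pd)
    else exist _ p0 (mem_set Pp0).
  have embK d : P d -> val (emb d) = d by rewrite /emb; case: pselect.
  apply: card_le_trans Plarge _.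
  apply: (@inj_in_card_le _ _ _ _ (fun c => (c.1, map emb c.2))) => //.
  move=> [n l] [m k] /set_mem /= Pl /set_mem /= Pk [-> e].
  congr (_, _); move/(congr1 (map val)): e; rewrite -!map_comp.
  by rewrite !map_id_in // => d /= ?; apply: embK; [exact: Pk | exact: Pl].
- move=> i li; apply: (Psmall (val i)); first exact/set_mem/valP.
  apply: card_le_trans li _.
  apply: (@inj_in_card_le _ _ _ _ (fun c => (c.1, map val c.2))).
    by move=> [n l] /= h d /mapP[e /h ? ->].
  by move=> [n l] [m k] _ _ [-> /(inj_map valI) ->].
- move=> i; have [|j Pj ij] := Pnomax (val i); first exact/set_mem/valP.
  by exists (exist _ j (mem_set Pj)).
Qed.

(** * Binary expansions and meager subsets of the line *)

Definition dense_strings (O : set (seq bool)) := forall s, exists u, O (s ++ u).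

Section Digits.
Variable R : realType.
Implicit Types (x y : R) (n : nat) (j : int) (s : seq bool).

(** The binary digit of weight 2^-(n+1), that is, the parity of floor(2^(n+1) x). *)
Definition digit x n : bool :=
  Num.floor (2 ^+ n.+1 * x) != 2 * Num.floor (2 ^+ n * x).

Lemma floor_digit x n :
  Num.floor (2 ^+ n.+1 * x) = 2 * Num.floor (2 ^+ n * x) + (digit x n)%:Z.
Proof.
rewrite /digit; set y := 2 ^+ n * x.
have -> : 2 ^+ n.+1 * x = 2 * y by rewrite exprS mulrA.
have /andP[h1 h2] := floor_itv y.
have /andP[h3 h4] := floor_itv (2 * y).
move: h1 h2 h3 h4; set a := Num.floor y; set b := Num.floor (2 * y).
move=> h1 h2 h3 h4.
have : (2 * a < b + 1)%R.
  by rewrite -(ltr_int R) intrM intrD; move: h1 h4; rewrite !intrD; lra.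
have : (b < 2 * a + 2)%R.
  by rewrite -(ltr_int R) intrD intrM; move: h2 h3; rewrite !intrD; lra.
by case: eqP => /= ? ? ?; lia.
Qed.

Lemma eq_floor_down x y n :
  Num.floor (2 ^+ n.+1 * x) = Num.floor (2 ^+ n.+1 * y) ->
  Num.floor (2 ^+ n * x) = Num.floor (2 ^+ n * y) /\ digit x n = digit y n.
Proof.
rewrite !floor_digit.
by case: (digit x n); case: (digit y n) => /= h; split=> //; lia.
Qed.

Lemma eq_floor_digits x y n :
  Num.floor (2 ^+ n * x) = Num.floor (2 ^+ n * y) ->
  mkseq (digit x) n = mkseq (digit y) n.
Proof.
elim: n => // n IH /eq_floor_down[/IH e d].
by rewrite /mkseq -addn1 iotaD !map_cat -!/(mkseq _ _) e /= d.
Qed.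

(** If floor(2^n x) = j and the next digits of x are [s], this is floor(2^(n + size s) x). *)
Definition dyadic j s : int := foldl (fun i (b : bool) => 2 * i + b%:Z) j s.

Lemma floor_dyadic x n j s :
  Num.floor (2 ^+ (n + size s)%N * x) = dyadic j s ->
  Num.floor (2 ^+ n * x) = j /\ mkseq (fun i => digit x (n + i)%N) (size s) = s.
Proof.
elim/last_ind: s => [|s b IH]; first by rewrite addn0.
rewrite size_rcons addnS /dyadic foldl_rcons -/(dyadic j s) floor_digit => e.
have [e1 e2] : Num.floor (2 ^+ (n + size s)%N * x) = dyadic j s /\
    digit x (n + size s)%N = b.
  by move: e; case: (digit x _); case: b => /= h; split=> //; lia.
have [-> h] := IH e1; split=> //.
by rewrite /mkseq -addn1 iotaD map_cat -/(mkseq _ _) h /= e2 cats1.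
Qed.

Lemma digits_cat x y n u :
  Num.floor (2 ^+ (n + size u)%N * x) = dyadic (Num.floor (2 ^+ n * y)) u ->
  mkseq (digit x) (n + size u) = mkseq (digit y) n ++ u.
Proof.
move=> /floor_dyadic[/eq_floor_digits <- e].
rewrite /mkseq iotaD map_cat -/(mkseq _ _); congr (_ ++ _).
by rewrite -[RHS]e /mkseq add0n -[X in iota X _]addn0 iotaDl -map_comp.
Qed.

(** Arbitrarily close to any point there is a dyadic interval of reals whose digits begin with a
    string in [O]; such an interval is disjoint from the set. *)
Lemma nowhere_dense_digits (O : set (seq bool)) : dense_strings O ->
  @nowhere_dense R [set x : R | ~ exists n, O (mkseq (digit x) n)].
Proof.
move=> Od; rewrite /nowhere_dense -subset0 => x0.
rewrite /interior /= -nbhs_ballE => -[e /= e0 sub].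
have [n ne] : exists n, (2 : R) ^- n < e.
  have [n _ h] := (near_infty_natSinv_expn_lt (PosNum e0)).
  by exists n; have := h n (leqnn n); rewrite /= div1r.
have [u Ou] := Od (mkseq (digit x0) n).
set j := Num.floor (2 ^+ n * x0) in Ou *.
set J := dyadic (Num.floor (2 ^+ n * x0)) u.
set N := (n + size u)%N.
have p0 k : 0 < (2 : R) ^+ k by rewrite exprn_gt0.
(* The midpoint of the dyadic interval, so that the ball of half its length around [z] stays
   inside. *)
pose z : R := (J%:~R + 2^-1) / 2 ^+ N.
have inB y : `|z - y| < 2^-1 / 2 ^+ N -> Num.floor (2 ^+ N * y) = J.
  have -> : y = (2 ^+ N * y) / 2 ^+ N by rewrite mulrC mulKf// gt_eqF.
  rewrite -mulrBl normrM (gtr0_norm (x := _^-1)) ?invr_gt0//.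
  rewrite ltr_pM2r ?invr_gt0// -[2 ^+ N * (_ / _)]mulrCA divff ?gt_eqF// mulr1.
  move: (2 ^+ N * y) => t; rewrite ltr_norml => /andP[h1 h2].
  by apply: floor_def; rewrite intrD; apply/andP; split; lra.
have zB : Num.floor (2 ^+ N * z) = J.
  by apply: inB; rewrite subrr normr0 divr_gt0.
have zx0 : ball x0 e z.
  rewrite /ball /=; apply: lt_trans ne.
  have [e1 _] := floor_dyadic zB.
  have /andP[h1 h2] := floor_itv (2 ^+ n * x0).
  have /andP[h3 h4] := floor_itv (2 ^+ n * z).
  rewrite -(ltr_pM2l (p0 n)) divff ?gt_eqF// -{1}(gtr0_norm (p0 n)) -normrM.
  rewrite mulrBr ltr_norml; move: h1 h2 h3 h4; rewrite e1 !intrD => *.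
  by apply/andP; split; lra.
have [] := sub _ zx0 (ball z (2^-1 / 2 ^+ N)).
  by apply: nbhsx_ballx; rewrite divr_gt0.
move=> y [/= Ny By]; apply: Ny; exists N.
by rewrite (digits_cat (y := x0)) //; apply: inB.
Qed.

(* Under cov(M) = c, this is Martin's axiom for families of fewer than c dense
   sets in the poset of binary strings. *)
Lemma generic_real (J : Type) (A : set J) (O : J -> set (seq bool)) :
  cov_meager_eq R [set: set nat] -> ~ ([set: set nat] #<= A) ->
  (forall i : J, A i -> dense_strings (O i)) ->
  exists x : nat -> bool, forall i : J, A i -> exists n, O i (mkseq x n).
Proof.
move=> [_ cov] nA Od; apply: contrapT => no; apply: nA.
pose M (j : J) : set R := [set x : R | ~ exists n, O j (mkseq (digit x) n)].
(* Without a generic sequence, the nowhere dense sets [M j] for [j] in [A] would cover the line. *)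
apply: card_le_trans (card_image_le M A); apply: cov; split.
  move=> _ [j Aj <-]; exists (fun=> M j); last by rewrite bigcup_const.
  by move=> _; apply/nowhere_dense_digits/Od.
rewrite -subTset => x _ /=; apply: contrapT => nx; apply: no; exists (digit x).
move=> j Aj; apply: contrapT => h; apply: nx; exists (M j) => //.
Qed.

End Digits.

(** * Recursion along well-founded relations *)

Lemma strict_well_order_wf (T : Type) (lt : rel T) :
  strict_well_order lt -> well_founded lt.
Proof.
move=> [_ _ _ ltmin] a; apply: contrapT => na.
have [|b nb m] := ltmin (fun a => ~ Acc lt a); first by exists a.
by apply: nb; constructor => c cb; apply: contrapT => /m; rewrite cb.
Qed.

(** Stage [i] chooses a value from the earlier ones; [x0] fills all other places, which [P] does not
    see by the last hypothesis. *)
Lemma well_founded_choice (T X : Type) (x0 : X) (lt : rel T)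
    (P : T -> (T -> X) -> X -> Prop) :
  well_founded lt -> (forall i x, exists y, P i x y) ->
  (forall i x x', (forall d, lt d i -> x d = x' d) ->
    forall y, P i x y -> P i x' y) ->
  exists x, forall i, P i x (x i).
Proof.
move=> ltwf Pex Pext.
have [F FP] := choice (fun ix => Pex ix.1 ix.2).
pose body i (rec : forall d, lt d i -> X) : X :=
  F (i, fun d => if pselect (lt d i) is left h then rec d h else x0).
pose x : T -> X := Fix ltwf (fun=> X) body.
have xE i : x i = body i (fun d _ => x d).
  rewrite /x Fix_eq// => j f g fg; congr (F (_, _)); apply: funext => d.
  by case: pselect.
exists x => i; rewrite xE; apply: Pext (FP (i, _)) => d /= di.
by case: pselect.
Qed.

(** * Open subsets of Z^N described by initial segments *)

Section Strings.
Implicit Types (g h : ZN) (V : set ZN) (y : nat -> bool) (k : int).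

Definition agree n g h := forall i, (i < n)%N -> g i = h i.

(** Openness in the product topology. *)
Definition cylindric V :=
  forall g, V g -> exists n, forall h, agree n g h -> V h.

Definition bits y : ZN := fun i => (y i : nat)%:Z.

Definition fin (p : seq int) : ZN := fun i => nth 0 p i.

Lemma addZNE g h i : (g + h) i = (g i : int) + h i. Proof. by []. Qed.
Lemma oppZNE g i : (- g) i = - (g i : int). Proof. by []. Qed.
Lemma mulrnZNE g n i : (g *+ n) i = (g i : int) *+ n.
Proof. by elim: n => // n IH; rewrite !mulrS addZNE IH. Qed.
Lemma mulrzZNE g k i : (g *~ k) i = (g i : int) * k.
Proof.
case: k => n; first by rewrite -pmulrn mulrnZNE pmulrn mulrzz.
by rewrite NegzE mulrNz oppZNE -pmulrn mulrnZNE mulrN pmulrn mulrzz.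
Qed.

Lemma agreeD n g g' h h' :
  agree n g g' -> agree n h h' -> agree n (g + h) (g' + h').
Proof. by move=> gg hh i ni; rewrite !addZNE gg// hh. Qed.

Lemma agreeZ n g g' k : agree n g g' -> agree n (g *~ k) (g' *~ k).
Proof. by move=> gg i ni; rewrite !mulrzZNE gg. Qed.

Lemma agree_mkseq n g h : agree n g h <-> mkseq g n = mkseq h n.
Proof.
split=> [gh|e i ni]; last by rewrite -(nth_mkseq (0 : int) g ni) e nth_mkseq.
by apply/eq_in_map => i; rewrite mem_iota => /andP[_ /gh].
Qed.

Lemma mkseq_nth_eq (X : Type) (x0 : X) (y : nat -> X) s i :
  mkseq y (size s) = s -> (i < size s)%N -> y i = nth x0 s i.
Proof. by move=> e si; rewrite -e nth_mkseq. Qed.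

Lemma agree_bits n y y' :
  (forall i, (i < n)%N -> y i = y' i) -> agree n (bits y) (bits y').
Proof. by move=> e i ni; rewrite /bits e. Qed.

(** Each pair (k, s) gives the coefficient and a prescribed initial segment of the next summand.
    Asking this for all lists says that the good tuples are dense. *)
Fixpoint reach V (ts : seq (int * seq bool)) h : Prop :=
  match ts with
  | [::] => V h
  | (k, s) :: ts' =>
      exists2 y, mkseq y (size s) = s & reach V ts' (h + bits y *~ k)
  end.

(* For open V this is a category quantifier: for all integers k_i and generic
   y_1, ..., y_m in 2^N, h + k_1 y_1 + ... + k_m y_m lies in V. *)
Definition thick V h := forall ts, reach V ts h.

Lemma reach_cylindric V ts : cylindric V -> cylindric (reach V ts).
Proof.
move=> cV; elim: ts => //= -[k s] ts IH g [y ys /IH[n nP]].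
exists n => h gh; exists y => //; apply: nP; exact: agreeD.
Qed.

(** Thickness provides a [y] extending [s], and by openness a finite initial segment of [y] already
    decides the matter. *)
Lemma thick_dense V h k ts : cylindric V -> thick V h ->
  dense_strings [set s | forall y, mkseq y (size s) = s ->
    reach V ts (h + bits y *~ k)].
Proof.
move=> cV th s; have [y ys /(reach_cylindric cV)[n nP]] := th ((k, s) :: ts).
exists (mkseq (fun i => y (size s + i)%N) n) => z; set t := s ++ _ => zt.
apply: nP; apply: agreeD => //; apply/agreeZ/agree_bits => i ni.
have tE : t = mkseq y (size s + n).
  rewrite /t -{1}ys /mkseq iotaD map_cat add0n; congr (_ ++ _).
  by rewrite -[in RHS](addn0 (size s)) iotaDl -map_comp.
move: zt; rewrite tE size_mkseq => /(congr1 (nth false ^~ i)).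
by rewrite !nth_mkseq//; lia.
Qed.

(** Each prescribed string is continued by zeros. *)
Lemma reach_fin V ts h : V (h + \sum_(a <- ts) bits (nth false a.2) *~ a.1) ->
  reach V ts h.
Proof.
elim: ts h => [|[k s] ts IH] h; first by rewrite big_nil addr0.
rewrite big_cons addrA => Vh; exists (nth false s); last exact: IH.
exact: mkseq_nth.
Qed.

End Strings.

(** An open set is determined by the strings whose cylinder it contains, hence by a set of naturals;
    largeness maps the codes onto all such sets. *)
Lemma cylindric_enum (T : choiceType) : large [set: T] ->
  exists V : nat * seq T -> set ZN, (forall b, cylindric (V b)) /\
    forall W, cylindric W -> exists b, V b = W.
Proof.
move=> /pcard_geP[g].
pose V b : set ZN :=
  [set h | exists n, g b (pickle (mkseq (h : nat -> int) n))].
exists V; split=> [b h [n hn]|W cW].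
  by exists n => h' /agree_mkseq e; exists n; rewrite -e.
pose A := [set m | exists2 s : seq int, pickle s = m &
  forall h : ZN, mkseq (h : nat -> int) (size s) = s -> W h].
have [b _ gb] := @surj _ _ _ _ g A I; exists b.
rewrite /V gb; apply/seteqP; split=> h /=.
  by move=> [n [s /(pcan_inj pickleK) -> ]]; apply; rewrite size_mkseq.
move=> /cW[n nW]; exists n; exists (mkseq (h : nat -> int) n) => // h'.
by rewrite size_mkseq => /esym/agree_mkseq/nW.
Qed.

(** * Integer combinations of 0-1 sequences and the tasks built on them *)

Section Span.
Variables (T : choiceType) (x : T -> nat -> bool).
Implicit Types (A : set T) (g h : ZN) (p : seq int) (l : seq (T * int)).

Definition comb p l : ZN := fin p + \sum_(a <- l) bits (x a.1) *~ a.2.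

Definition span A : set ZN :=
  [set g | exists p l, (forall a, a \in l -> A a.1) /\ g = comb p l].

Lemma fin_span A p : span A (fin p).
Proof. by exists p, [::]; split=> //; rewrite /comb big_nil addr0. Qed.

Lemma finB p q : exists r, fin p - fin q = fin r.
Proof.
exists (mkseq (fun i => nth 0 p i - nth 0 q i) (maxn (size p) (size q))).
apply: funext => i; rewrite addZNE oppZNE /fin.
have [im|im] := ltnP i (maxn (size p) (size q)); first by rewrite nth_mkseq.
rewrite !(nth_default _ (s := _)) ?size_mkseq ?subrr//.
  exact: leq_trans (leq_maxr _ _) im.
exact: leq_trans (leq_maxl _ _) im.
Qed.

Lemma spanB A g h : span A g -> span A h -> span A (g - h).
Proof.
move=> [p [l [lA ->]]] [q [m [mA ->]]].
have [r re] := finB p q.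
exists r, (l ++ [seq (a.1, - a.2) | a <- m]); split.
  by move=> a; rewrite mem_cat => /orP[/lA//|/mapP[b /mA ? ->]].
rewrite /comb -re big_cat big_map /= opprD addrACA; congr (_ + (_ + _)).
by rewrite -sumrN; apply: eq_bigr => a _; rewrite mulrNz.
Qed.

Lemma span0 A : span A 0.
Proof.
suff -> : 0 = fin [::] by exact: fin_span.
by apply: funext => i; rewrite /fin nth_nil.
Qed.

Lemma span_subset A B : A `<=` B -> span A `<=` span B.
Proof. by move=> AB g [p [l [lA ->]]]; exists p, l; split=> // a /lA/AB. Qed.

Lemma span_addZ A g d k : span A g -> A d -> span A (g + bits (x d) *~ k).
Proof.
move=> [p [l [lA ->]]] Ad; exists p, ((d, k) :: l); split.
  by move=> a; rewrite inE => /orP[/eqP->|/lA].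
by rewrite /comb big_cons /= -addrA [X in _ + X]addrC.
Qed.

Lemma bits_span A d : A d -> span A (bits (x d)).
Proof.
move=> Ad; rewrite -[bits _]add0r -[X in _ + X]mulr1z.
exact/span_addZ/Ad/span0.
Qed.

Lemma span_sum A g (l : seq T) (c : T -> int) : span A g ->
  (forall d, d \in l -> A d) -> span A (g + \sum_(d <- l) bits (x d) *~ c d).
Proof.
elim: l g => [|d l IH] g gA lA; first by rewrite big_nil addr0.
rewrite big_cons addrA; apply: IH => [|e el]; last first.
  by apply: lA; rewrite inE el orbT.
by apply: span_addZ => //; apply: lA; rewrite mem_head.
Qed.

(** Coefficients of equal indices are added up, and indices with total 0 are dropped. *)
Lemma span_normal A g : span A g -> exists p (l : seq T) (c : T -> int),
  [/\ uniq l, forall d, d \in l -> A d, forall d, d \in l -> c d != 0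
    & g = fin p + \sum_(d <- l) bits (x d) *~ c d].
Proof.
move=> [p [l [lA ->]]].
pose c d := \sum_(a <- l | a.1 == d) a.2.
pose u := undup (map fst l).
exists p, [seq d <- u | c d != 0], c; split.
- by rewrite filter_uniq// undup_uniq.
- by move=> d; rewrite mem_filter mem_undup => /andP[_ /mapP[a /lA ? ->]].
- by move=> d; rewrite mem_filter => /andP[].
rewrite /comb; congr (_ + _); rewrite big_filter [RHS]big_mkcond /=.
rewrite [RHS](eq_bigr (fun d =>
  \sum_(a <- l | a.1 == d) bits (x a.1) *~ a.2)); last first.
  move=> d _; have -> : \sum_(a <- l | a.1 == d) bits (x a.1) *~ a.2 =
    bits (x d) *~ c d.
    by rewrite mulrz_sumr; apply: eq_bigr => a /eqP->.
  by case: eqP => //= ->; rewrite mulr0z.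
rewrite (exchange_big_dep xpredT)//= big_seq [RHS]big_seq.
apply: eq_bigr => a al; rewrite -big_filter.
have -> : [seq d <- u | a.1 == d] = [:: a.1]; last by rewrite big_seq1.
rewrite (eq_filter (a2 := pred1 a.1)); last by move=> d; rewrite /= eq_sym.
by rewrite filter_pred1_uniq ?undup_uniq// mem_undup map_f.
Qed.

Lemma span_bounded A g : span A g ->
  exists b : nat, forall i, (`|g i : int| <= b)%N.
Proof.
have bD (g1 g2 : ZN) : (exists b : nat, forall i, (`|g1 i : int| <= b)%N) ->
   (exists b : nat, forall i, (`|g2 i : int| <= b)%N) ->
   exists b : nat, forall i, (`|(g1 + g2) i : int| <= b)%N.
  move=> [b gb] [b' gb']; exists (b + b')%N => i; rewrite addZNE.
  by have := gb i; have := gb' i; lia.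
move=> [p [l [_ ->]]]; apply: (bD).
  exists (\max_(a <- p) `|a|%N) => i; rewrite /fin.
  have [ip|ip] := ltnP i (size p); last by rewrite nth_default.
  by apply: (leq_bigmax_seq (F := fun a : int => `|a|%N)) => //; exact: mem_nth.
apply: (big_ind (fun f : ZN =>
  exists b : nat, forall i, (`|f i : int| <= b)%N)) => //.
- by exists 0%N.
- move=> a _; exists `|a.2|%N => i; rewrite mulrzZNE /bits.
  by case: (x _ _); rewrite ?mul1r ?mul0r.
Qed.

End Span.

(* A task (e, b, p, l, k, ts) asks the next real y to force
   [reach W ts (comb x p l + bits y *~ k)], where W is V b if e is 0 and
   [off_one n] if e is n + 1. *)
Definition task (T : Type) : Type :=
  (nat * (nat * seq T) * seq int * seq (T * int)) *
  (int * seq (int * seq bool)).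

Definition tasks (T : choiceType) (A : set T) : set (task T) :=
  [set j | (forall d, d \in j.1.1.1.2.2 -> A d) /\
           (forall a, a \in j.1.2 -> A a.1)].

Lemma cat_inj (X : Type) (s1 s2 t1 t2 : seq X) :
  size s1 = size t1 -> s1 ++ s2 = t1 ++ t2 -> s1 = t1 /\ s2 = t2.
Proof.
by elim: s1 t1 => [|a s1 IH] [|b t1] //= [/IH{}IH] [-> /IH[-> ->]].
Qed.

Lemma unzip_inj (X Y : Type) (s t : seq (X * Y)) :
  unzip1 s = unzip1 t -> unzip2 s = unzip2 t -> s = t.
Proof. by move=> e1 e2; rewrite -(zip_unzip s) e1 e2 zip_unzip. Qed.

(** Everything in a task except its indices is countable and goes into the tag. The length of the
    first index list is recorded there, so that the concatenation can be split again. *)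
Lemma large_tasks (T : choiceType) (A : set T) :
  [set: set nat] #<= tasks A -> large A.
Proof.
move=> /card_le_trans; apply.
pose f (j : task T) := let: (e, b, p, l, kts) := j in
  (pickle (e, b.1, size b.2, p, unzip2 l, kts), b.2 ++ unzip1 l).
apply: (@inj_in_card_le _ _ _ _ f) => [[[[[e [n b]] p] l] kts] [/= bA lA] d|].
  by rewrite mem_cat => /orP[/bA//|/mapP[a /lA ? ->]].
move=> [[[[e [n b]] p] l] kts] [[[[e' [n' b']] p'] l'] kts'] _ _.
move=> [/(pcan_inj pickleK)[-> -> sb -> l2 ->]] /cat_inj[//|-> l1].
by rewrite (unzip_inj l1 l2).
Qed.

(** * Generic families of binary sequences *)

Section Generic.
Variables (T : choiceType) (lt : rel T) (V : nat * seq T -> set ZN).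
Implicit Types (x : T -> nat -> bool) (h g : ZN).

Definition off_one n : set ZN := [set g | exists2 i, (n <= i)%N & g i <> 1].

Definition task_set (eb : nat * (nat * seq T)) : set ZN :=
  if eb.1 is n.+1 then off_one n else V eb.2.

Definition demand x (j : task T) : set (seq bool) :=
  let: (eb, p, l, (k, ts)) := j in
  [set s | forall y, mkseq y (size s) = s ->
     reach (task_set eb) ts (comb x p l + bits y *~ k)].

(** Cohen genericity of each [x i] over the tasks whose indices are below [i]. *)
Definition generic x := forall i j, tasks [set d | lt d i] j ->
  dense_strings (demand x j) -> demand x j `&` range (mkseq (x i)) !=set0.

Lemma generic_exists (R : realType) :
  cov_meager_eq R [set: set nat] -> strict_well_order lt ->
  (forall i, ~ large [set d | lt d i]) -> exists x, generic x.
Proof.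
move=> covM ltwo small.
apply: (well_founded_choice (fun=> false) (lt := lt)
  (P := fun i x y => forall j, tasks [set d | lt d i] j ->
  dense_strings (demand x j) -> demand x j `&` range (mkseq y) !=set0)).
- exact: strict_well_order_wf.
- move=> i x.
  pose A := tasks [set d | lt d i] `&` [set j | dense_strings (demand x j)].
  (* Continuum many tasks would make the segment below [i] large. *)
  have nA : ~ ([set: set nat] #<= A).
    move=> h; apply: (small i); apply: large_tasks; apply: card_le_trans h _.
    by apply: subset_card_le => j [].
  have [y yP] := generic_real covM nA (fun j Aj => Aj.2).
  by exists y => j jt jd; have [n ny] := yP j (conj jt jd); exists (mkseq y n).
(* A task with indices below [i] mentions only values of [x] below [i]. *)
- move=> i x x' xx' y yP j jt.
  suff <- : demand x j = demand x' j by exact: yP.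
  move: j jt => [[[eb p] l] [k ts]] [/= _ lt_l]; rewrite /demand /comb.
  suff -> : \sum_(a <- l) bits (x a.1) *~ a.2 =
            \sum_(a <- l) bits (x' a.1) *~ a.2 by [].
  by rewrite big_seq [RHS]big_seq; apply: eq_bigr => a /lt_l/= /xx' ->.
Qed.

Section Consequences.
Variable x : T -> nat -> bool.
Hypotheses (xgen : generic x) (ltwo : strict_well_order lt).

Let below i := [set d | lt d i].

Lemma generic_reach eb p l k ts i : tasks (below i) (eb, p, l, (k, ts)) ->
  dense_strings (demand x (eb, p, l, (k, ts))) ->
  reach (task_set eb) ts (comb x p l + bits (x i) *~ k).
Proof.
move=> jt /(xgen jt)[s [jd [n _ ns]]]; apply: jd.
by rewrite -ns size_mkseq.
Qed.

Lemma lt_total (i j : T) : i != j -> ~~ lt i j -> lt j i.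
Proof.
move=> ij nij; apply/negPn/negP => nji; have [_ _ tot _] := ltwo.
by rewrite (tot i j) ?eqxx in ij.
Qed.

Lemma exists_min (l : seq T) : l != [::] ->
  exists2 i, i \in l & forall d, d \in l -> d != i -> lt i d.
Proof.
move=> l0; have [_ _ _ wf] := ltwo.
have [|i il m] := wf [set d | d \in l].
  by case: l l0 => // d l _; exists d; exact: mem_head.
by exists i => // d dl di; apply: lt_total di _; exact: m.
Qed.

Lemma exists_max (l : seq T) : l != [::] ->
  exists2 i, i \in l & forall d, d \in l -> d != i -> lt d i.
Proof.
have [_ tr _ _] := ltwo.
elim: l => // d l IH _; have [->|/IH[i il m]] := eqVneq l [::].
  by exists d; rewrite ?mem_head// => e; rewrite inE => /eqP->; rewrite eqxx.
have [di|ndi] := boolP (lt d i).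
  by exists i => [|e]; rewrite inE ?il ?orbT// => /orP[/eqP->//|/m].
have [di|di] := eqVneq d i.
  exists i => [|e]; rewrite inE ?il ?orbT// => /orP[/eqP->|/m//].
  by rewrite di eqxx.
have id := lt_total di ndi.
exists d => [|e]; rewrite ?mem_head// inE => /orP[/eqP->|/m em ed].
  by rewrite eqxx.
by have [->//|/em /tr] := eqVneq e i; exact.
Qed.

(** For every [ts] the corresponding task lies below [i] and its demand is dense by [thick_dense],
    so [x i] meets it. *)
Lemma thick_step b h k i : cylindric (V b) -> (forall d, d \in b.2 -> lt d i) ->
  span x (below i) h -> thick (V b) h -> thick (V b) (h + bits (x i) *~ k).
Proof.
move=> cV bi [p [l [li ->]]] th ts.
apply: (@generic_reach (0%N, b)); first by split.
exact: thick_dense.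
Qed.

(** The summands are added in increasing order of index, which keeps each partial sum in the span
    below the next index. *)
Lemma thick_sum b h (l : seq T) (c : T -> int) : cylindric (V b) -> uniq l ->
  (forall i, i \in l -> span x (below i) h /\ forall d, d \in b.2 -> lt d i) ->
  thick (V b) h -> V b (h + \sum_(i <- l) bits (x i) *~ c i).
Proof.
move=> cV; have [n] := ubnP (size l); elim: n l h => // n IH l h.
have [-> _ _ _ /(_ [::])|l0 ln ul lP th] := eqVneq l [::].
  by rewrite big_nil addr0.
have [i il m] := exists_min l0.
rewrite (big_rem i)//= addrA; have [hi bi] := lP _ il.
have [_ tr _ _] := ltwo.
apply: IH; last exact: thick_step.
- by rewrite size_rem//; move: ln; case: (l) l0.
- exact: rem_uniq.
- move=> d; rewrite mem_rem_uniq// inE => /andP[di dl].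
  have [hd bd] := lP _ dl; split=> //; apply: span_addZ => //.
  exact: m.
Qed.

(** The largest index [i] has a nonzero coefficient and the rest lies in the span below [i], so
    genericity of [x i] yields a value other than 1 beyond [n]. *)
Lemma span_off_one g n : span x setT g -> off_one n g.
Proof.
move=> /span_normal[p [l [c [ul _ c0 ->]]]].
have [->|l0] := eqVneq l [::].
  rewrite big_nil addr0; exists (maxn n (size p)); first exact: leq_maxl.
  by rewrite /fin nth_default// leq_maxr.
have [i il m] := exists_max l0.
rewrite (big_rem i)//= addrA addrAC.
set h := fin p + _.
have [q [k [ki ->]]] : span x (below i) h.
  apply: span_sum => [|d]; first exact: fin_span.
  by rewrite mem_rem_uniq// inE => /andP[di dl]; exact: m.
apply: (@generic_reach (n.+1, (0%N, [::])) q k (c i) [::]); first by split.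
move=> s; pose N := maxn n (size s).
(* Changing the digit at [N] changes the value there, because [c i] is nonzero. *)
have [b hb] : exists b : bool, (comb x q k N : int) + (b : nat)%:Z * c i != 1.
  have := c0 i il; have [e|e] := eqVneq (comb x q k N : int) 1.
    by exists true; rewrite e; lia.
  by exists false; rewrite mul0r addr0.
exists (rcons (nseq (N - size s) false) b) => y yE; exists N.
  exact: leq_maxl.
rewrite addZNE mulrzZNE /bits.
have -> : y N = b; last exact/eqP.
have sN : (size s <= N)%N := leq_maxr _ _.
rewrite (mkseq_nth_eq false yE); last first.
  by rewrite size_cat size_rcons size_nseq; lia.
by rewrite nth_cat ltnNge sN /= nth_rcons size_nseq ltnn eqxx.
Qed.

(** * Long runs of ones, and Rothberger selections of strings *)

Section Enum.
Hypotheses (Vcyl : forall b, cylindric (V b))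
  (Vsurj : forall W, cylindric W -> exists b, V b = W)
  (nomax : forall i, exists j, lt i j) (T0 : inhabited T).

Lemma exists_above (l : seq T) : exists i, forall d, d \in l -> lt d i.
Proof.
have [i0] := T0.
have [->|/exists_max[i il m]] := eqVneq l [::]; first by exists i0.
have [k ik] := nomax i; exists k => d /m dm.
by have [->//|/dm di] := eqVneq d i; have [_ tr _ _] := ltwo; exact: tr ik.
Qed.

(** The index [i] only has to lie above the code of the open set [W]. The bound [N] enters through
    the finitely supported part of the task, so one [i] serves all [N]. *)
Lemma bits_runs (J : nat -> nat) : exists i, forall N, exists2 n, (N <= n)%N &
  forall m, (n <= m <= n + J n)%N -> x i m.
Proof.
pose W : set ZN :=
  [set g | exists n, forall m, (n <= m <= n + J n)%N -> g m = 1].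
have cW : cylindric W.
  move=> g [n gn]; exists (n + J n).+1 => h gh; exists n => m mn.
  by rewrite -gh ?gn//; case/andP: mn.
have [b bW] := Vsurj cW; have [i bi] := exists_above b.2.
exists i => N.
(* Adding 2 below N rules out the runs that start below N. *)
have : reach (task_set (0%N, b)) [::]
    (comb x (nseq N 2) [::] + bits (x i) *~ 1).
  apply: generic_reach; first by split.
  move=> s; pose n := maxn N (size s).
  exists (nseq (n + J n).+1 true) => y yE; rewrite /= /task_set /= bW.
  exists n => m /andP[nm mn]; rewrite addZNE mulrzZNE /bits.
  rewrite (mkseq_nth_eq false yE); last by rewrite size_cat size_nseq; lia.
  have sm : (size s <= m)%N by apply: leq_trans nm; exact: leq_maxr.
  rewrite nth_cat ltnNge sm nth_nseq /= ifT; last by lia.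
  rewrite /comb big_nil addr0 /fin nth_nseq ifF//.
  by apply/negbTE; rewrite -leqNgt; apply: leq_trans nm; exact: leq_maxl.
rewrite /= /task_set /= bW => -[n nP].
have gE m : (comb x (nseq N 2) [::] + bits (x i) *~ 1) m =
    (if (m < N)%N then 2 else 0) + (x i m : nat)%:Z :> int.
  by rewrite addZNE mulrzZNE mulr1 /comb big_nil addr0 /fin nth_nseq.
exists n.
  rewrite leqNgt; apply/negP => nN; have := nP n; rewrite gE nN.
  by rewrite leqnn leq_addr => /(_ isT); case: (x i n).
move=> m /nP; rewrite gE.
by case: ifP; case: (x i m).
Qed.

(* A generic real y codes the choice f n := the string number j, where j is
   least with y (n + j) = 1; genericity over the tasks below i makes the
   resulting open set thick at all members of the span of x below i. *)
Lemma thick_selector (R : realType) (Gd : nat -> set (seq int)) i :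
  cov_meager_eq R [set: set nat] -> ~ large (below i) ->
  (forall n g, span x setT g -> exists l, Gd n (mkseq (g : nat -> int) l)) ->
  exists f : nat -> seq int,
  exists2 b, V b = [set g | exists n,
    Gd n (f n) /\ mkseq (g : nat -> int) (size (f n)) = f n] &
  forall h, span x (below i) h -> thick (V b) h.
Proof.
move=> covM small GdP.
pose dec (y : nat -> bool) n : seq int :=
  if pselect (exists j, y (n + j)%N) is left e then
    odflt [::] (unpickle (ex_minn e)) else [::].
have decE (y : nat -> bool) n (s : seq int) : y (n + pickle s)%N ->
    (forall j, (j < pickle s)%N -> y (n + j)%N = false) -> dec y n = s.
  move=> ys ns; rewrite /dec.
  case: pselect => [e|[]]; last by exists (pickle s).
  case: ex_minnP => j yj mj.
  suff -> : j = pickle s by rewrite pickleK.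
  apply/eqP; rewrite eqn_leq mj//= leqNgt; apply/negP => /ns.
  by rewrite yj.
pose W f : set ZN := [set g | exists n,
  Gd n (f n) /\ mkseq (g : nat -> int) (size (f n)) = f n].
pose O (j : task T) : set (seq bool) :=
  [set s | forall y, mkseq y (size s) = s ->
    reach (W (dec y)) j.2.2 (comb x j.1.1.2 j.1.2)].
have [||y yP] := @generic_real R _ (tasks (below i)) O covM.
- by move=> /large_tasks.
- move=> [[[eb p] l] [k ts]] [/= _ lA] s.
  set h := comb x p l; pose g := h + \sum_(a <- ts) bits (nth false a.2) *~ a.1.
  have bF (t : seq bool) : exists q, bits (nth false t) = fin q.
    exists (map (fun b : bool => (b : nat)%:Z) t); apply: funext => m.
    rewrite /bits /fin; have [mt|mt] := ltnP m (size t).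
      by rewrite (nth_map false).
    by rewrite !nth_default// size_map.
  have gS : span x setT g.
    rewrite /g; elim: (ts) => [|a us IH].
      rewrite big_nil addr0; exists p, l; split=> //.
    rewrite big_cons [_ *~ _ + _]addrC addrA.
    have [q ->] := bF a.2.
    suff [r ->] : exists r, fin q *~ a.1 = - fin r.
      by apply: spanB => //; exact: fin_span.
    exists (map (fun z => - (z * a.1)) q); apply: funext => m.
    rewrite mulrzZNE oppZNE /fin; have [mq|mq] := ltnP m (size q).
      by rewrite (nth_map 0) // opprK.
    by rewrite !nth_default ?size_map ?mul0r ?oppr0.
  (* The string [s] leaves the positions from [size s] on free, so the choice number [size s] can
     still be coded at will. *)
  have [m Gm] := GdP (size s) g gS.
  set z := mkseq _ m in Gm.
  (* The unary code of [z], read by [dec] from position [size s]. *)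
  exists (rcons (nseq (pickle z) false) true) => y yE.
  apply: reach_fin; exists (size s).
  have yn j : (j <= pickle z)%N -> y (size s + j)%N = (j == pickle z).
    move=> jz; rewrite (mkseq_nth_eq false yE).
      rewrite nth_cat ltnNge leq_addr /= addKn nth_rcons size_nseq nth_nseq.
      by case: ltngtP jz => // ->.
    by rewrite size_cat size_rcons size_nseq; lia.
  rewrite (decE y (size s) z) ?size_mkseq//; first by rewrite yn// eqxx.
  by move=> j jz; rewrite yn ?ltn_eqF// ltnW.
have cW : cylindric (W (dec y)).
  move=> g [n [Gn gn]]; exists (size (dec y n)) => g' /agree_mkseq e.
  by exists n; rewrite -e.
have [b bW] := Vsurj cW.
exists (dec y), b => // h [p [l [lA ->]]] ts.
have [|n] := yP ((0%N, (0%N, [::])), p, l, (0, ts)); first by split.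
by rewrite bW; apply; rewrite size_mkseq.
Qed.

(** The Rothberger property in terms of strings: [Gd n] will consist of the strings whose cylinder
    lies in one member of the n-th cover. *)
Lemma string_Rothberger (R : realType) (Gd : nat -> set (seq int)) :
  cov_meager_eq R [set: set nat] -> (forall i, ~ large (below i)) ->
  (forall n g, span x setT g -> exists l, Gd n (mkseq (g : nat -> int) l)) ->
  exists f : nat -> seq int, forall g, span x setT g ->
    exists n, Gd n (f n) /\ mkseq (g : nat -> int) (size (f n)) = f n.
Proof.
move=> covM small GdP; have [_ tr _ _] := ltwo.
(* Step [j] handles the covers numbered [pickle (j, n)]. The new index exceeds the old one and all
   indices in the code of the selected open set. *)
have step (ji : nat * T) : exists fi : (nat -> seq int) * T, lt ji.2 fi.2 /\
    exists b, [/\ V b = [set g | exists n, Gd (pickle (ji.1, n)) (fi.1 n) /\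
                 mkseq (g : nat -> int) (size (fi.1 n)) = fi.1 n],
      forall d, d \in b.2 -> lt d fi.2
    & forall h, span x (below ji.2) h -> thick (V b) h].
  case: ji => j i.
  have [|f [b bE bth]] :=
    @thick_selector R (fun n => Gd (pickle (j, n))) i covM (small i).
    by move=> n; exact: GdP.
  have [i' i'P] := exists_above (i :: b.2).
  exists (f, i'); split; first by apply: i'P; exact: mem_head.
  by exists b; split=> // d db; apply: i'P; rewrite inE db orbT.
have [F FP] := choice step.
have [i0] := T0.
pose fix kap j := if j is j'.+1 then (F (j', kap j')).2 else i0.
have kapS d j k : (j <= k)%N -> lt d (kap j) -> lt d (kap k).
  elim: k => [|k IH]; first by rewrite leqn0 => /eqP->.
  rewrite leq_eqVlt => /orP[/eqP->//|/IH/[apply] dk].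
  by apply: tr dk _; have [] := FP (k, kap k).
exists (fun m =>
  if unpickle m is Some (j, n) then (F (j, kap j)).1 n else [::]).
move=> g /span_normal[p [l [c [ul _ _ gE]]]].
(* The intervals [kap j, kap (j+1)) are pairwise disjoint, so the finite list [l] misses one of
   them. *)
have [j jP] : exists j, forall d, d \in l -> lt d (kap j.+1) -> lt d (kap j).
  apply: contrapT => no.
  have w_ex j : exists d, [/\ d \in l, lt d (kap j.+1) & ~~ lt d (kap j)].
    apply: contrapT => nj; apply: no; exists j => d dl dj.
    by apply: contrapT => /negP ndj; apply: nj; exists d.
  have [w wP] := choice w_ex.
  have wI : injective w.
    suff lI j k : (j < k)%N -> w j <> w k.
      by move=> j k e; case: (ltngtP j k) => // /lI; rewrite e.
    move=> jk e; have [_ dj _] := wP j; have [_ _ /negP] := wP k; apply.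
    by rewrite -e; apply: kapS dj.
  have := @uniq_leq_size _ (map w (iota 0 (size l).+1)) l.
  rewrite map_inj_uniq// iota_uniq size_map size_iota ltnn => /(_ isT) h.
  suff : false by [].
  by apply: h => _ /mapP[j _ ->]; have [] := wP j.
have [_ [b [bE bd bth]]] := FP (j, kap j).
have : V b g.
  (* [V b] is thick at the part of [g] with indices below [kap j]; the other indices are at least
     [kap j.+1], hence above those in [b]. *)
  rewrite gE (bigID (fun d => lt d (kap j)))/= addrA.
  rewrite -big_filter -[X in _ + X]big_filter.
  have hS : span x (below (kap j)) (fin p +
      \sum_(d <- [seq d <- l | lt d (kap j)]) bits (x d) *~ c d).
    apply: span_sum; first exact: fin_span.
    by move=> d; rewrite mem_filter => /andP[].
  apply: thick_sum => //; [exact: filter_uniq| |exact: bth].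
  move=> i; rewrite mem_filter => /andP[ni il].
  have ik d : lt d (kap j.+1) -> lt d i.
    move=> dk; have [<-//|/lt_total h] := eqVneq (kap j.+1) i.
    by apply: tr dk _; apply/negPn/negP => /h /(jP _ il); exact/negP.
  split=> [|d /bd]; last exact: ik.
  by apply: span_subset hS => d /= dj; apply: ik; apply: kapS dj.
rewrite bE => -[n nP]; exists (pickle (j, n)).
by rewrite pickleK.
Qed.

End Enum.
End Consequences.
End Generic.

(** * Topology of subgroups of Z^N and their covering properties *)

(** The sets containing a cylinder around [g] form a filter that converges to [g] in each
    coordinate. *)
Lemma nbhs_agree_ZN (g : ZN) (W : set ZN) :
  nbhs g W -> exists n, forall h, agree n g h -> W h.
Proof.
pose F : set_system ZN := [set W | exists n, forall h, agree n g h -> W h].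
have FF : Filter F.
  split; first by exists 0%N.
    move=> P Q [n nP] [m mQ]; exists (maxn n m) => h gh; split.
      by apply: nP => i im; apply: gh; rewrite leq_max im.
    by apply: mQ => i im; apply: gh; rewrite leq_max im orbT.
  by move=> P Q PQ [n nP]; exists n => h /nP/PQ.
suff : F --> g by apply.
apply/cvg_sup => i U [_ [/= [W' oW <-] /= Wg]] /filterS; apply.
by exists i.+1 => h gh /=; rewrite -gh.
Qed.

Section Subgroup.
Variable G : zmodClosed ZN.
Implicit Types g h : subgroup G.

Lemma nbhs_agree g U : nbhs g U ->
  exists n, forall h, agree n (val g) (val h) -> U h.
Proof.
move=> [_ [/= [W oW <-] /= Wg]] WU.
have [n nW] := nbhs_agree_ZN (open_nbhs_nbhs (conj oW Wg)).
by exists n => h /nW/WU.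
Qed.

Lemma open_agree n (f : ZN) : open [set g : subgroup G | agree n f (val g)].
Proof.
rewrite openE => g fg.
suff : nbhs g [set h | agree n (val g) (val h)].
  by apply: filterS => h gh i ni; rewrite fg// gh.
elim: n {fg} => [|n IH]; first by apply: filterS filterT.
have gn : nbhs g [set h : subgroup G | (val h : ZN) n = (val g : ZN) n].
  have pn : nbhs (val g : ZN) [set f : ZN | f n = (val g : ZN) n].
    have := @proj_continuous nat (fun=> discrete_topology int) n (val g)
      [set (val g : ZN) n].
    by apply; exact: discrete_set1.
  have vc : continuous (val : subgroup G -> ZN) by exact: initial_continuous.
  exact: vc pn.
apply: filterS2 IH gn => h gh e i; rewrite ltnS leq_eqVlt => /orP[/eqP->//|].
exact: gh.
Qed.

(** Members bounded by n show finitely many patterns on the first [k n] coordinates, and one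
    representative of each suffices. A member bounded by b is caught for all n >= b. *)
Lemma Hurewicz_bounded_of_bounded :
  (forall g, exists b : nat, forall i, (`|(val g : ZN) i : int| <= b)%N) ->
  Hurewicz_bounded (subgroup G).
Proof.
move=> Gb U U0; have [k kU] := choice (fun n => nbhs_agree (U0 n)).
(* Adding [n] moves values from [-n, n] to [0, 2n], where [inord] loses nothing. *)
pose code n h : {ffun 'I_(k n) -> 'I_(n.*2.+1)} :=
  [ffun i : 'I_(k n) => inord (absz ((val h : ZN) i + n%:Z : int))].
pose rep n c : subgroup G := xget 0 [set h | (forall i : 'I_(k n),
  (`|(val h : ZN) i : int| <= n)%N) /\ code n h = c].
exists (fun n => range (rep n)); split.
  by move=> n; apply: finite_image; exact: finite_finset.
move=> g; have [b gb] := Gb g; exists b => // n /= bn.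
have gn (i : 'I_(k n)) : (`|(val g : ZN) i : int| <= n)%N.
  exact: leq_trans (gb i) bn.
have := @xgetPex _ 0 [set h | (forall i : 'I_(k n),
  (`|(val h : ZN) i : int| <= n)%N) /\ code n h = code n g].
rewrite -/(rep n (code n g)); case; first by exists g.
set r := rep n _ => rn /ffunP rg.
exists r; first by exists (code n g).
exists (g - r); last by rewrite addrC subrK.
apply: kU => i ik.
have := rg (Ordinal ik); rewrite !ffunE /= => /(congr1 val) /=.
have := gn (Ordinal ik); have := rn (Ordinal ik) => /=.
rewrite addZNE oppZNE -[(0 : ZN) i]/(0 : int).
move: ((sval r : ZN) i) ((sval g : ZN) i) => /= u v un vn.
by rewrite !inordK; lia.
Qed.

(** A cover may be replaced by the strings whose cylinder lies in one of its members. *)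
Lemma Rothberger_of_strings :
  (forall Gd : nat -> set (seq int),
    (forall n g, exists l, Gd n (mkseq ((val g : ZN) : nat -> int) l)) ->
    exists f : nat -> seq int, forall g, exists n, Gd n (f n) /\
      mkseq ((val g : ZN) : nat -> int) (size (f n)) = f n) ->
  Rothberger_property (subgroup G).
Proof.
move=> GR U Uc.
pose Gd n : set (seq int) := [set s | exists2 A, U n A &
  forall g, mkseq ((val g : ZN) : nat -> int) (size s) = s -> A g].
have [n g|f fP] := GR Gd.
  have [Uo UT] := Uc n; have : [set: subgroup G] g by [].
  rewrite -UT => -[A UA Ag].
  have [l lA] := nbhs_agree (open_nbhs_nbhs (conj (Uo A UA) Ag)).
  exists l, A => // h; rewrite size_mkseq => e; apply: lA.
  by apply/agree_mkseq; rewrite e.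
have AP n : exists A, U n A /\ (Gd n (f n) ->
    forall g, mkseq ((val g : ZN) : nat -> int) (size (f n)) = f n -> A g).
  have [[A UA AP]|nG] := pselect (Gd n (f n)); first by exists A.
  (* Any member of the cover will do here; one exists because 0 is covered. *)
  have [_ UT] := Uc n; have : [set: subgroup G] 0 by [].
  by rewrite -UT => -[A UA _]; exists A.
have [A AU] := choice AP.
exists A; split=> [n|]; first by have [] := AU n.
rewrite -subTset => g _; have [n [Gn gn]] := fP g.
by exists n => //; have [_ /(_ Gn g gn)] := AU n.
Qed.

(** The sets [A n j] increase with [j], so a finite selection lies in a single [A n (J n)]. An
    element constantly 1 on [n, n + J n] for infinitely many n escapes it infinitely often. *)
Lemma not_Hurewicz_of_runs :
  (forall g n, exists2 i, (n <= i)%N & (val g : ZN) i <> 1) ->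
  (forall J : nat -> nat, exists g, forall N, exists2 n, (N <= n)%N &
    forall i, (n <= i <= n + J n)%N -> (val g : ZN) i = 1) ->
  ~ Hurewicz_property (subgroup G).
Proof.
move=> off runs hur.
pose A n j : set (subgroup G) :=
  [set g | exists2 i, (n <= i <= n + j)%N & (val g : ZN) i <> 1].
have Amono n j j' : (j <= j')%N -> A n j `<=` A n j'.
  by move=> jj g [i ij gi]; exists i => //; lia.
have Ao n j : open (A n j).
  rewrite openE => g [i ij gi].
  have := @open_agree i.+1 (val g); rewrite openE => /(_ g).
  move=> /(_ (fun _ _ => erefl)); apply: filterS => h gh.
  by exists i => //; rewrite -gh.
have [|F [FU Fcov]] := hur (fun n => range (A n)).
  move=> n; split=> [_ [j _ <-]//|].
  rewrite -subTset => g _; have [i ni gi] := off g n.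
  exists (A n (i - n)%N); first by exists (i - n)%N.
  by exists i => //; lia.
have JP n : exists j, forall B, F n B -> B `<=` A n j.
  have [/finite_seqP[s sE] FA] := FU n.
  have {FA} : forall B, B \in s -> exists j, B `<=` A n j.
    move=> B Bs; have : F n B by rewrite sE.
    by move=> /FA[j _ <-]; exists j.
  rewrite sE => {sE}; elim: s => [|B s IH] sA; first by exists 0%N.
  have [|j jP] := IH; first by move=> C Cs; apply: sA; rewrite inE Cs orbT.
  have [j' j'P] := sA B (mem_head _ _).
  exists (maxn j j') => C /=; rewrite inE => /orP[/eqP->|Cs].
    by apply: subset_trans j'P _; apply: Amono; exact: leq_maxr.
  by apply: subset_trans (jP C Cs) _; apply: Amono; exact: leq_maxl.
have [J JA] := choice JP.
have [g gruns] := runs J; have [N _ NP] := Fcov g.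
have [n Nn nP] := gruns N.
have [B FB Bg] := NP n Nn.
by have [i /nP] := JA n B FB g Bg.
Qed.

End Subgroup.

(** * Implications between the properties *)

Lemma Rothberger_Menger (X : topologicalType) :
  Rothberger_property X -> Menger_property X.
Proof.
move=> rot U /rot[A [UA AT]]; exists (fun n => [set A n]); split.
  by move=> n; split=> [|_ ->//]; exact: finite_set1.
by rewrite -AT; apply: eq_bigcupr => n _; rewrite bigcup_set1.
Qed.

Lemma Hurewicz_Menger_bounded (G : topologicalZmodType) :
  Hurewicz_bounded G -> Menger_bounded G.
Proof.
move=> hur U /hur[F [Ff Fc]]; exists F; split=> //.
rewrite -subTset => g _; have [N _ NP] := Fc g.
by exists N => //; apply: NP => /=.
Qed.

(** The covers consist of the interiors of all translates of [U n]. *)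
Lemma Rothberger_property_bounded (G : topologicalZmodType) :
  Rothberger_property G -> Rothberger_bounded G.
Proof.
move=> rot U U0.
pose C n : set (set G) := range (fun a => interior [set g | U n (g - a)]).
have [|A [CA AT]] := rot C.
  move=> n; split=> [_ [a _ <-]|]; first exact: open_interior.
  rewrite -subTset => g _.
  exists (interior [set h | U n (h - g)]); first by exists g.
  rewrite /interior /=.
  have c : {for g, continuous (fun h : G => h - g)}.
    apply: (@continuous_comp _ (G * G)%type _ (fun h => (h, g))
      (fun p => p.1 - p.2)); last exact: sub_continuous.
    by apply: cvg_pair; [exact: cvg_id|exact: cvg_cst].
  by apply: c; rewrite subrr; exact: U0.
have /choice[a aP] n : exists a, A n = interior [set g | U n (g - a)].
  by have [a _ <-] := CA n; exists a.
exists a; rewrite -subTset => g _; have : [set: G] g by [].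
rewrite -AT => -[n _]; rewrite aP => /interior_subset /= Ug.
exists n => //; exists (a n) => //; exists (g - a n) => //.
by rewrite addrC subrK.
Qed.

(** * The span as a subgroup, and the theorem *)

Section SpanGroup.
Variables (T : choiceType) (x : T -> nat -> bool).

Definition span_group : {pred ZN} := fun g => `[< span x setT g >].

Lemma span_groupP g : reflect (span x setT g) (g \in span_group).
Proof. exact: asboolP. Qed.

Lemma span_group_closed : zmod_closed span_group.
Proof.
split=> [|g h /span_groupP gS /span_groupP hS]; apply/span_groupP.
  exact: span0.
exact: spanB.
Qed.

HB.instance Definition _ :=
  GRing.isZmodClosed.Build ZN span_group span_group_closed.

End SpanGroup.

Local Close Scope ring_scope.
Local Close Scope card_scope.

Theorem theorem9p10 (R : realType) (covM : cov_meager_eq R [set: set nat]) :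
  exists G : zmodClosed ZN,
    [/\ Hurewicz_bounded (subgroup G), Menger_bounded (subgroup G)
      & Rothberger_bounded (subgroup G)] /\
    [/\ Menger_property (subgroup G), Rothberger_property (subgroup G)
      & ~ Hurewicz_property (subgroup G)].
Proof.
have [T [lt [ltwo Tlarge small nomax]]] := large_well_order.
have [i0 _] := large_nonempty Tlarge.
have [V [Vcyl Vsurj]] := cylindric_enum Tlarge.
have [x xgen] := generic_exists V covM ltwo small.
pose G : zmodClosed ZN := span_group x; exists G.
have GS (g : subgroup G) : span x setT (val g) by apply/span_groupP/valP.
have hb : Hurewicz_bounded (subgroup G).
  by apply: Hurewicz_bounded_of_bounded => g; exact: span_bounded (GS g).
have rp : Rothberger_property (subgroup G).
  apply: Rothberger_of_strings => Gd GdP.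
  have [n g gS|f fP] := string_Rothberger xgen ltwo Vcyl Vsurj nomax
    (inhabits i0) (Gd := Gd) covM small.
    by have := GdP n (exist _ g (introT (span_groupP x g) gS)).
  by exists f => g; exact: fP.
split; split=> //.
- exact: Hurewicz_Menger_bounded.
- exact: Rothberger_property_bounded.
- exact: Rothberger_Menger.
apply: not_Hurewicz_of_runs => [g n|J].
  exact: (span_off_one xgen ltwo n (GS g)).
have [i iP] := bits_runs xgen ltwo Vsurj nomax (inhabits i0) J.
have iS : span x setT (bits (x i)) by exact: bits_span.
exists (exist _ (bits (x i)) (introT (span_groupP x _) iS)) => N.
have [n Nn nP] := iP N; exists n => // m /nP xm.
by rewrite /= /bits xm.
Qed.
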